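(* Let $n\ge2$ be an integer, let $\mathcal{D}\subset\mathbb{R}^2$ be a set of size $n$, let $-1<\eta<1$ be non-zero, and let $A$ be the attractor of the IFS $\Psi_n=\{F_d\}_{d\in\mathcal{D}}$, $$F_d(\vec x)=\begin{pmatrix}\eta&1\\0&\eta\end{pmatrix}\vec x+d,\qquad d\in\mathcal{D}.$$ Then the extreme points of $A$ are described by a DGIFS with finitely many equations and functions $F_d$ where $d\in\mathcal{D}\cap\partial\operatorname{conv}(\mathcal{D})$.
   Context: The attractor $A$ is the unique non-empty compact set with $A=\bigcup_{d\in\mathcal{D}}F_d(A)$. The set of extreme points of $A$ is $\operatorname{ext}(A)=A\cap\partial\operatorname{conv}(A)$ (all points of $A$ on the boundary of its convex hull, not only vertices). DGIFS: a directed graph iterated function system consists of a finite directed graph $(V,E)$ (loops and multiple edges allowed, every vertex of out-degree at least $1$), with $E_{uv}$ the edges from $u$ to $v$, and a contraction $f_e$ for each edge $e$ (contractions with respect to a common norm on $\mathbb{R}^2$). It has a unique list of non-empty compact sets $\{B_u\}_{u\in V}$ with $B_u=\bigcup_{v\in V}\bigcup_{e\in E_{uv}}f_e(B_v)$ for all $u\in V$ (one equation per vertex). The extreme points ''are described by'' the DGIFS with functions $F_d$, $d\in S$, if every $f_e$ is one of the maps $F_d$ with $d\in S$ and $\operatorname{ext}(A)=\bigcup_{u\in V}B_u$. *)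

(* Defs.v *)
From HB Require Import structures.
From mathcomp Require Import all_boot all_order all_algebra.
From mathcomp Require Import all_classical all_reals all_analysis.

Set Implicit Arguments.
Unset Strict Implicit.
Unset Printing Implicit Defensive.

Import Order.TTheory GRing.Theory Num.Theory.
Import numFieldNormedType.Exports.

Local Open Scope classical_set_scope.
Local Open Scope ring_scope.

(* The Euclidean topology on the plane is that of the (sup-norm) normed module
   'cV[R]_2, all norms on the plane being equivalent. *)

Definition convex_hull (R : realType) (X : set 'cV[R]_2) : set 'cV[R]_2 :=
  smallest (@convex_set R 'cV[R]_2) X.

Definition boundary (T : topologicalType) (X : set T) : set T :=
  closure X `\` X°.

(* All the points on the boundary of the convex hull, not only the vertices. *)
Definition extreme_points (R : realType) (A : set 'cV[R]_2) : set 'cV[R]_2 :=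
  A `&` boundary (convex_hull A).

Definition jordan_block (R : realType) (eta : R) : 'M[R]_2 :=
  \matrix_(i, j) (if i == j then eta else if (i < j)%N then 1 else 0).

Definition ifs_map (R : realType) (eta : R) (d : 'cV[R]_2) :
    'cV[R]_2 -> 'cV[R]_2 :=
  fun x => jordan_block eta *m x + d.

(* Uniqueness of the attractor is a consequence of these conditions when the
   F d are contractions and D is finite; it is not assumed. *)
Definition is_attractor (R : realType) (D : set 'cV[R]_2)
    (F : 'cV[R]_2 -> 'cV[R]_2 -> 'cV[R]_2) (A : set 'cV[R]_2) : Prop :=
  [/\ A !=set0, compact A & A = \bigcup_(d in D) (F d @` A)].

Definition is_norm (R : realType) (N : 'cV[R]_2 -> R) : Prop :=
  [/\ forall x y, N (x + y) <= N x + N y,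
      forall (a : R) x, N (a *: x) = `|a| * N x
    & forall x, N x = 0 -> x = 0].

Definition contraction_for (R : realType) (N : 'cV[R]_2 -> R)
    (f : 'cV[R]_2 -> 'cV[R]_2) : Prop :=
  exists2 c : R, 0 <= c < 1 & forall x y, N (f x - f y) <= c * N (x - y).

(* Edges form a type of their own, so that loops and multiple edges are
   allowed; an edge e goes from [src e] to [tgt e]. *)
Record dgifs (R : realType) := Dgifs {
  vertex : finType;
  edge : finType;
  src : edge -> vertex;
  tgt : edge -> vertex;
  edge_map : edge -> 'cV[R]_2 -> 'cV[R]_2;
  out_degree_gt0 : forall u, exists e, src e = u;
  edge_map_contraction : exists2 N : 'cV[R]_2 -> R, is_norm N &
    forall e, contraction_for N (edge_map e) }.

Definition edges (R : realType) (G : dgifs R) (u v : vertex G) :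
    set (edge G) :=
  [set e | src e = u /\ tgt e = v].

Definition is_attractor_list (R : realType) (G : dgifs R)
    (B : vertex G -> set 'cV[R]_2) : Prop :=
  forall u, [/\ B u !=set0, compact (B u) &
    B u = \bigcup_v \bigcup_(e in edges u v) (edge_map e @` B v)].

Definition described_by_dgifs (R : realType) (X S : set 'cV[R]_2)
    (F : 'cV[R]_2 -> 'cV[R]_2 -> 'cV[R]_2) : Prop :=
  exists G : dgifs R,
    (forall e : edge G, exists2 d, S d & edge_map e = F d) /\
    exists2 B : vertex G -> set 'cV[R]_2,
      is_attractor_list B & X = \bigcup_u B u.

(* Main.v *)
Require Import Defs.
From HB Require Import structures.
From mathcomp Require Import all_boot all_order all_algebra.
From mathcomp Require Import all_classical all_reals all_analysis.
From mathcomp Require Import ring lra.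

Import Order.TTheory GRing.Theory Num.Theory.
Import numFieldNormedType.Exports.

Local Open Scope classical_set_scope.
Local Open Scope ring_scope.

(* For a direction w let A_w be the face of A on which <w, .> is maximal. Then
   ext(A) is the union of the A_w over w <> 0, and A_w is the union of
   F_d(A_{M^T w}) over d in D_w, where M is the Jordan block. In the slope
   coordinate tau = sgn(eta) w_2 / w_1, M^T acts as the translation
   tau |-> tau + 1/|eta|, up to the sign of w_1; for each sign of w_1, D_w is
   constant on tau > T and on tau < -T. Hence the following finite family of sets is
   a graph-directed system:
   - the faces A_w with w vertical;
   - the faces A_w with tau >= -T: only finitely many are distinct, because the
     sequence D_w, D_{M^T w}, ... determines A_w and is constant up to the sign
     of w_1 after a number of steps independent of w;
   - for each sign of w_1, the union of all A_w with tau in [-oo, -T], which is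
     compact and is mapped into its partner by the single relevant F_d. *)

(** * Faces and boundary points of the convex hull *)

Definition lin {R : realType} (p q : R) (x : 'cV[R]_2) : R :=
  p * x 0 0 + q * x 1 0.

Definition face {R : realType} (X : set 'cV[R]_2) (p q : R) : set 'cV[R]_2 :=
  [set x | X x /\ forall y, X y -> lin p q y <= lin p q x].

Section Faces.
Set Implicit Arguments.
Unset Strict Implicit.
Context {R : realType}.
Implicit Types (X : set 'cV[R]_2) (x y : 'cV[R]_2) (p q : R).

(** If [P] has points on both sides of the axis a = 0, convexity and the missing half-axis make
    every slope b / a with a > 0 at most every slope with a < 0, so the line of slope [sup S]
    through the origin bounds [P] from above. Otherwise the axis itself bounds [P]. *)
Lemma plane_separation (P : R -> R -> Prop) :
  (forall a b a' b' (t : R), 0 <= t <= 1 -> P a b -> P a' b' ->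
    P (t * a + (1 - t) * a') (t * b + (1 - t) * b')) ->
  (forall b : R, 0 < b -> ~ P 0 b) ->
  exists u v : R, (u != 0) || (v != 0) /\ forall a b, P a b -> u * a + v * b <= 0.
Proof.
move=> cP P0.
have cross a b a' b' : P a b -> P a' b' -> 0 < a -> a' < 0 ->
    b / a <= - (b' / - a').
  move=> Pab Pab' a0 a'0.
  have s0 : 0 < a - a' by lra.
  (* This weight puts the convex combination on the axis a = 0. *)
  have t01 : 0 <= - a' / (a - a') <= 1.
    by rewrite divr_ge0 ?ler_pdivrMr; lra.
  have := cP _ _ _ _ _ t01 Pab Pab'.
  have -> : - a' / (a - a') * a + (1 - - a' / (a - a')) * a' = 0.
    by field; rewrite gt_eqF.
  have -> : - a' / (a - a') * b + (1 - - a' / (a - a')) * b'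
      = (b / a + b' / - a') * (a * - a' / (a - a')).
    by field; rewrite (gt_eqF s0) (lt_eqF a'0) (gt_eqF a0).
  move=> H; rewrite leNgt; apply/negP => lt0.
  apply: P0 H; apply: mulr_gt0; first by rewrite -(opprK (_ / - _)) subr_gt0.
  by rewrite divr_gt0 // mulr_gt0 // oppr_gt0.
have [[a1 [b1 [P1 a1p]]]|nP1] := pselect (exists a b, P a b /\ 0 < a); last first.
  exists 1, 0; rewrite oner_eq0; split=> // a b Pab.
  rewrite mul1r mul0r addr0 leNgt; apply/negP => a0; apply: nP1.
  by exists a, b.
have [[a2 [b2 [P2 a2n]]]|nP2] := pselect (exists a b, P a b /\ a < 0); last first.
  exists (-1), 0; rewrite oppr_eq0 oner_eq0; split=> // a b Pab.
  rewrite mulN1r mul0r addr0 oppr_le0 leNgt; apply/negP => a0; apply: nP2.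
  by exists a, b.
pose S := [set s | exists a b, [/\ P a b, 0 < a & s = b / a]].
have S0 : S !=set0 by exists (b1 / a1), a1, b1.
have ubS a b : P a b -> a < 0 -> ubound S (- (b / - a)).
  by move=> Pab a0 _ [a' [b' [Pab' a'0 ->]]]; apply: cross.
exists (- sup S), 1; rewrite oner_eq0 orbT; split=> // a b Pab.
rewrite mul1r mulNr addrC subr_le0.
case: (ltgtP a 0) => [a0|a0|a0].
- have : sup S <= - (b / - a) by apply: ge_sup => //; apply: ubS.
  by rewrite invrN mulrN opprK ler_ndivlMr.
- rewrite -ler_pdivrMr //; apply: sup_upper_bound; last by exists a, b.
  by split=> //; exists (- (b2 / - a2)); apply: ubS.
- rewrite a0 mulr0 leNgt; apply/negP => b0.
  by apply: (P0 b) => //; rewrite -a0.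
Qed.

Lemma lin_convex p q c : convex_set [set x : 'cV[R]_2 | lin p q x <= c].
Proof.
move=> x y t /set_mem /= xc /set_mem /= yc; apply/mem_set => /=.
rewrite /conv /= /lin !mxE /= /unstable.onem.
have t0 : 0 <= t%:num by [].
have t1 : t%:num <= 1 by [].
move: xc yc; rewrite /lin => xc yc.
have h1 : t%:num * (p * x 0 0 + q * x 1 0) <= t%:num * c by apply: ler_wpM2l.
have h2 : (1 - t%:num) * (p * y 0 0 + q * y 1 0) <= (1 - t%:num) * c.
  by apply: ler_wpM2l => //; lra.
lra.
Qed.

Lemma convex_hull_lin X p q c :
  (forall x, X x -> lin p q x <= c) ->
  forall x, convex_hull X x -> lin p q x <= c.
Proof.
move=> Xc x Hx; apply: (Hx [set y | lin p q y <= c]).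
by split=> //; apply: lin_convex.
Qed.

Lemma sub_convex_hull X : X `<=` convex_hull X.
Proof. by move=> x Xx C [_]; apply. Qed.

Lemma convex_hull_conv X x y (t : R) : 0 <= t <= 1 ->
  convex_hull X x -> convex_hull X y -> convex_hull X (t *: x + (1 - t) *: y).
Proof.
move=> t01 Xx Xy C [cC XC].
have /mem_set xC : C x by apply: Xx.
have /mem_set yC : C y by apply: Xy.
have ti : Itv.spec (@Itv.num_sem R) (Itv.Real `[0%Z, 1%Z]) t.
  by rewrite /= /Itv.num_sem /= in_itv /= t01 andbT num_real.
by have /set_mem := cC x y (Itv.mk ti) xC yC.
Qed.

Definition vec2 (a b : R) : 'cV[R]_2 := \col_i (if i == 0 then a else b).

Lemma vec2_0 a b : vec2 a b 0 0 = a. Proof. by rewrite mxE. Qed.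
Lemma vec2_1 a b : vec2 a b 1 0 = b. Proof. by rewrite mxE. Qed.

Lemma eq_cV2 x y : x 0 0 = y 0 0 -> x 1 0 = y 1 0 -> x = y.
Proof.
move=> h0 h1; apply/colP => -[[|[|i]] Hi] //.
  by rewrite (_ : Ordinal Hi = 0) //; apply/val_inj.
by rewrite (_ : Ordinal Hi = 1) //; apply/val_inj.
Qed.

Lemma addr_vec2 x y : x + vec2 (y 0 0 - x 0 0) (y 1 0 - x 1 0) = y.
Proof. by apply: eq_cV2; rewrite mxE ?vec2_0 ?vec2_1 addrC subrK. Qed.

Lemma nbhs_cV2 (x : 'cV[R]_2) (U : set 'cV[R]_2) :
  nbhs x U <-> exists2 e : R, 0 < e &
    forall a b, `|a| < e -> `|b| < e -> U (x + vec2 a b).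
Proof.
split=> [/nbhs_ballP[e /= e0 eU]|[e e0 eU]].
  exists e => // a b ae be; apply: eU; split=> // i j.
  rewrite /ball /= !mxE opprD addNKr normrN.
  by case: ifP.
apply/nbhs_ballP; exists e => // y [_ xy].
by rewrite -(addr_vec2 x y); apply: eU; rewrite distrC; apply: xy.
Qed.

Lemma lin_vec2 p q x a b : lin p q (x + vec2 a b) = lin p q x + (p * a + q * b).
Proof. by rewrite /lin mxE [in q * _]mxE vec2_0 vec2_1; ring. Qed.

(** If [x] were interior, a small step along (p, q) would stay in the hull and yet raise the
    functional above its maximum. *)
Lemma face_sub_extreme X p q : (p != 0) || (q != 0) ->
  face X p q `<=` extreme_points X.
Proof.
move=> pq0 x [Xx xmax]; split=> //; split.
  by apply: subset_closure; apply: sub_convex_hull.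
move=> /nbhs_cV2 [e e0 eU].
pose s : R := e / (2 * (`|p| + `|q| + 1)).
have np := normr_ge0 p; have nq := normr_ge0 q.
have D0 : 0 < 2 * (`|p| + `|q| + 1) by lra.
have s0 : 0 < s by apply: divr_gt0.
have bnd (r : R) : `|r| <= `|p| + `|q| -> `|s * r| < e.
  move=> rle; rewrite normrM gtr0_norm // /s mulrAC ltr_pdivrMr // ltr_pM2l //.
  lra.
have := eU (s * p) (s * q) (bnd _ _) (bnd _ _).
move=> /(_ ltac:(lra) ltac:(lra)) /(convex_hull_lin xmax).
rewrite lin_vec2 gerDl leNgt => /negP; apply.
have -> : p * (s * p) + q * (s * q) = s * (p ^+ 2 + q ^+ 2) by ring.
apply: mulr_gt0 => //; case/orP: pq0 => h.
  by rewrite ltr_wpDr ?sqr_ge0 // exprn_even_gt0.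
by rewrite ltr_wpDl ?sqr_ge0 // exprn_even_gt0.
Qed.

(** If the hull misses one of the four coordinate half-axes issuing from [x], swapping or reflecting
    coordinates turns it into the half-axis of [plane_separation], which yields the functional. If
    it meets all four, [x] is interior. *)
Lemma extreme_sub_face X x : extreme_points X x ->
  exists p q : R, (p != 0) || (q != 0) /\ face X p q x.
Proof.
move=> [Xx [_ nint]].
have Cx := sub_convex_hull Xx.
set C := convex_hull X in Cx nint.
suff [p [q [pq0 H]]] : exists p q : R, (p != 0) || (q != 0) /\
    forall a b, C (x + vec2 a b) -> p * a + q * b <= 0.
  exists p, q; split=> //; split=> // y Xy.
  rewrite -(addr_vec2 x y) lin_vec2 gerDl; apply: H; rewrite addr_vec2.
  exact: sub_convex_hull.
have cC a b a' b' (t : R) : 0 <= t <= 1 -> C (x + vec2 a b) -> C (x + vec2 a' b') ->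
    C (x + vec2 (t * a + (1 - t) * a') (t * b + (1 - t) * b')).
  move=> t01 H1 H2; have := convex_hull_conv t01 H1 H2.
  congr (C _); apply: eq_cV2; rewrite !mxE /=; ring.
have [p1|n1] := pselect (exists2 t : R, 0 < t & C (x + vec2 t 0)); last first.
  have [||u [v [uv0 H]]] := @plane_separation (fun a b => C (x + vec2 b a)).
  - by move=> a b a' b' t t01 H1 H2; apply: cC.
  - by move=> b b0 Cb; apply: n1; exists b.
  - by exists v, u; rewrite orbC; split=> // a b /H; rewrite addrC.
have [p2|n2] := pselect (exists2 t : R, 0 < t & C (x + vec2 (- t) 0)); last first.
  have [||u [v [uv0 H]]] := @plane_separation (fun a b => C (x + vec2 (- b) a)).
  - move=> a b a' b' t t01 H1 H2 /=.
    by rewrite opprD -!mulrN; apply: cC.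
  - by move=> b b0 Cb; apply: n2; exists b.
  - exists (- v), u; rewrite oppr_eq0 orbC; split=> // a b.
    by rewrite -{1}(opprK a) => /H; rewrite mulrN -mulNr addrC.
have [p3|n3] := pselect (exists2 t : R, 0 < t & C (x + vec2 0 t)); last first.
  have [||u [v [uv0 H]]] := @plane_separation (fun a b => C (x + vec2 a b)).
  - by move=> a b a' b' t t01 H1 H2; apply: cC.
  - by move=> b b0 Cb; apply: n3; exists b.
  - by exists u, v; split=> // a b /H.
have [p4|n4] := pselect (exists2 t : R, 0 < t & C (x + vec2 0 (- t))); last first.
  have [||u [v [uv0 H]]] := @plane_separation (fun a b => C (x + vec2 a (- b))).
  - move=> a b a' b' t t01 H1 H2 /=.
    by rewrite opprD -!mulrN; apply: cC.
  - by move=> b b0 Cb; apply: n4; exists b.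
  - exists u, (- v); rewrite oppr_eq0; split=> // a b.
    by rewrite -{1}(opprK b) => /H; rewrite mulrN -mulNr.
have C0 : C (x + vec2 0 0).
  by rewrite (_ : x + vec2 0 0 = x) //; apply: eq_cV2; rewrite mxE ?vec2_0 ?vec2_1 addr0.
case: p1 p2 p3 p4 => [t1 t10 C1] [t2 t20 C2] [t3 t30 C3] [t4 t40 C4].
have Cray (u v t : R) : 0 < t -> C (x + vec2 (u * t) (v * t)) ->
    forall s, 0 <= s <= t -> C (x + vec2 (u * s) (v * s)).
  move=> t0 Ct s /andP[s0 st].
  have s01 : 0 <= s / t <= 1 by rewrite divr_ge0 ?(ltW t0) //= ler_pdivrMr ?mul1r.
  have := cC _ _ _ _ _ s01 Ct C0.
  by rewrite !mulr0 !addr0 ![s / t * _]mulrC -!mulrA ![t * _]mulrC divfK ?gt_eqF.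
have [e [e0 e1 e2 e3 e4]] : exists e : R, [/\ 0 < e, e <= t1, e <= t2, e <= t3 & e <= t4].
  exists (Num.min (Num.min t1 t2) (Num.min t3 t4)).
  by rewrite !lt_min t10 t20 t30 t40 !ge_min !lexx !orbT.
have Ch a : `|a| <= e -> C (x + vec2 a 0).
  move=> ae; case: (lerP 0 a) => a0.
    have := Cray 1 0 t1 t10 _ a; rewrite !mul1r !mul0r; apply=> //.
    by rewrite a0 (le_trans _ (le_trans ae e1)) // ler_norm.
  have := Cray (-1) 0 t2 t20 _ (- a); rewrite !mulN1r !mul0r opprK; apply=> //.
  by rewrite oppr_ge0 ltW //= -ltr0_norm // (le_trans ae).
have Cv a : `|a| <= e -> C (x + vec2 0 a).
  move=> ae; case: (lerP 0 a) => a0.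
    have := Cray 0 1 t3 t30 _ a; rewrite !mul1r !mul0r; apply=> //.
    by rewrite a0 (le_trans _ (le_trans ae e3)) // ler_norm.
  have := Cray 0 (-1) t4 t40 _ (- a); rewrite !mulN1r !mul0r opprK; apply=> //.
  by rewrite oppr_ge0 ltW //= -ltr0_norm // (le_trans ae).
case: nint; apply/nbhs_cV2; exists (e / 2); first by rewrite divr_gt0.
move=> a b ae be.
have h01 : 0 <= (2^-1 : R) <= 1 by lra.
(* The displacement (a, b) is the midpoint of (2a, 0) and (0, 2b), which lie on the cross of
   half-length [e] contained in the hull. *)
have := cC (2 * a) 0 0 (2 * b) 2^-1 h01.
have -> : 2^-1 * (2 * a) + (1 - 2^-1) * 0 = a by lra.
have -> : 2^-1 * 0 + (1 - 2^-1) * (2 * b) = b by lra.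
apply; [apply: Ch|apply: Cv]; rewrite normrM ger0_norm //; lra.
Qed.

End Faces.

(** * Existence and compactness of faces *)

Section Topology.
Set Implicit Arguments.
Unset Strict Implicit.
Context {R : realType}.
Implicit Types (X : set 'cV[R]_2) (p q : R).

Lemma lin_continuous (T : topologicalType) (p q : T -> R) (f : T -> 'cV[R]_2) :
  continuous p -> continuous q -> continuous f ->
  continuous (fun z => lin (p z) (q z) (f z)).
Proof.
move=> cp cq cf z.
have c i : {for z, continuous (fun z => f z i 0)}.
  apply: (@continuous_comp _ _ _ f (fun y : 'cV[R]_2 => y i 0)); first exact: cf.
  exact: coord_continuous.
exact: (continuousD (continuousM (cp z) (c 0)) (continuousM (cq z) (c 1))).
Qed.

Lemma face_scale X c p q : 0 < c -> face X (c * p) (c * q) = face X p q.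
Proof.
move=> c0; have linc x : lin (c * p) (c * q) x = c * lin p q x.
  by rewrite /lin; ring.
apply/seteqP; split=> x [Xx H]; split=> // y /H.
  by rewrite !linc ler_pM2l.
by rewrite !linc ler_pM2l.
Qed.

Lemma face_neq0 X p q : X !=set0 -> compact X -> face X p q !=set0.
Proof.
move=> X0 cX.
have [|c /set_mem Xc H] := compact_EVT_max (f := lin p q) X0 cX.
  apply/continuous_subspaceT.
  apply: (lin_continuous (T := 'cV[R]_2) (p := cst p) (q := cst q) (f := id)).
  - exact: cst_continuous.
  - exact: cst_continuous.
  - by move=> z; exact: cvg_id.
by exists c; split=> // y /mem_set /H.
Qed.

(** The pairs (a, x) with x in the face at parameter a form a closed part of [0, r] times [X], cut
    out by one closed inequality for each y in [X]; the union is its projection. *)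
Lemma segment_faces_compact X (p q : R -> R) (r : R) : compact X ->
  continuous p -> continuous q ->
  compact (\bigcup_(a in [set a | 0 <= a <= r]) face X (p a) (q a)).
Proof.
move=> cX cp cq.
pose Y : set (R * 'cV[R]_2) := `[0, r] `*` X.
pose W : set (R * 'cV[R]_2) :=
  \bigcap_(y in X) [set z | lin (p z.1) (q z.1) y - lin (p z.1) (q z.1) z.2 <= 0].
have cY : compact Y by apply: compact_setX => //; exact: segment_compact.
have cW : closed W.
  apply: closed_bigI => y Xy.
  apply: (@preimage_closed _ _ (fun z : R * 'cV[R]_2 =>
    lin (p z.1) (q z.1) y - lin (p z.1) (q z.1) z.2) [set t | t <= 0]); last first.
    exact: closed_le.
  have c1 : continuous (fun z : R * 'cV[R]_2 => p z.1).
    by move=> z; apply: (@continuous_comp _ _ _ fst p); [exact: cvg_fst|exact: cp].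
  have c2 : continuous (fun z : R * 'cV[R]_2 => q z.1).
    by move=> z; apply: (@continuous_comp _ _ _ fst q); [exact: cvg_fst|exact: cq].
  have c3 : continuous (fun z : R * 'cV[R]_2 => lin (p z.1) (q z.1) y).
    by apply: (lin_continuous (f := cst y)) => //; exact: cst_continuous.
  have c4 : continuous (fun z : R * 'cV[R]_2 => lin (p z.1) (q z.1) z.2).
    by apply: (lin_continuous (f := snd)) => // ?; exact: cvg_snd.
  by move=> z _; exact: (continuousB (c3 z) (c4 z)).
rewrite (_ : \bigcup_(_ in _) _ = snd @` (Y `&` W)); last first.
  symmetry; apply/seteqP; split=> [x [[a y] /= [[/= ar Xy] Wy] <-]|x].
    exists a; first by move: ar; rewrite /= in_itv.
    by split=> // t /Wy /=; rewrite subr_le0.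
  move=> [a /= ar [Xx H]]; exists (a, x) => //; split.
    by split; rewrite /= ?in_itv.
  by move=> y Xy /=; rewrite subr_le0; apply: H.
apply: continuous_compact; last exact: compact_closedI.
by apply/continuous_subspaceT => ?; exact: cvg_snd.
Qed.

Lemma face_compact X p q : compact X -> compact (face X p q).
Proof.
move=> cX; have := segment_faces_compact (p := cst p) (q := cst q) (r := 0) cX
  (@cst_continuous _ _ p) (@cst_continuous _ _ q).
rewrite (_ : \bigcup_(_ in _) _ = face X p q) //.
apply/seteqP; split=> [x [a _ []]//|x Hx].
by exists 0; rewrite //= lexx.
Qed.

End Topology.

(** * The iterated function system of a Jordan block *)

Section JordanIFS.
Set Implicit Arguments.
Unset Strict Implicit.
Context {R : realType} (eta : R).
Implicit Types (X D A S : set 'cV[R]_2) (x y d : 'cV[R]_2) (p q : R).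
Local Notation F := (ifs_map eta).

Lemma ifs_map0 d x : F d x 0 0 = eta * x 0 0 + x 1 0 + d 0 0.
Proof.
rewrite /ifs_map !mxE big_ord_recl big_ord1 !mxE /= mul1r.
by rewrite (_ : lift ord0 ord0 = 1) //; apply/val_inj.
Qed.

Lemma ifs_map1 d x : F d x 1 0 = eta * x 1 0 + d 1 0.
Proof.
rewrite /ifs_map !mxE big_ord_recl big_ord1 !mxE /= mul0r add0r.
by rewrite (_ : lift ord0 ord0 = 1) //; apply/val_inj.
Qed.

(** The pair (eta p, p + eta q) is the image of (p, q) under the transposed Jordan block. *)
Lemma lin_ifs p q d x :
  lin p q (F d x) = lin (eta * p) (p + eta * q) x + lin p q d.
Proof. by rewrite /lin ifs_map0 ifs_map1; ring. Qed.

(** By [lin_ifs] the functional at [F d a] is a term in a plus a term in d, and the two are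
    maximised independently. *)
Lemma face_attractor D A p q : is_attractor D F A ->
  face A p q =
    \bigcup_(d in face D p q) (F d @` face A (eta * p) (p + eta * q)).
Proof.
move=> [A0 cA EA]; apply/seteqP; split=> x.
  move=> [Ax H]; move: (Ax); rewrite {1}EA => -[d Dd [a Aa xE]].
  have FA e y : D e -> A y -> A (F e y) by move=> De Ay; rewrite EA; exists e => //; exists y.
  exists d; last exists a => //.
    split=> // e De; have := H _ (FA e a De Aa).
    by rewrite -xE !lin_ifs lerD2l.
  split=> // y Ay; have := H _ (FA d y Dd Ay).
  by rewrite -xE !lin_ifs lerD2r.
move=> [d [Dd Hd] [a [Aa Ha] <-]]; split; first by rewrite EA; exists d => //; exists a.
move=> y; rewrite {1}EA => -[e De [b Ab <-]].
by rewrite !lin_ifs lerD ?Ha ?Hd.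
Qed.

(** The off-diagonal entry 1 spoils contraction in the sup norm. The weight K = 2 / (1 - |eta|)
    solves 1 + K |eta| = K (1 + |eta|) / 2, which gives all maps the ratio (1 + |eta|) / 2. *)
Definition skew_norm x : R := `|x 0 0| + 2 / (1 - `|eta|) * `|x 1 0|.

Hypothesis eta1 : `|eta| < 1.

Let K_ge1 : 1 <= 2 / (1 - `|eta|).
Proof.
have e1 := eta1; have h0 := normr_ge0 eta.
by rewrite ler_pdivlMr; lra.
Qed.

Let K_gt0 : 0 < 2 / (1 - `|eta|). Proof. exact: lt_le_trans ltr01 K_ge1. Qed.

Lemma skew_norm_is_norm : is_norm skew_norm.
Proof.
have K0 := K_gt0.
split=> [x y|a x|x].
- have H0 := ler_normD (x 0 0) (y 0 0).
  have H1 := ler_wpM2l (ltW K0) (ler_normD (x 1 0) (y 1 0)).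
  rewrite /skew_norm !mxE; rewrite mulrDr in H1; lra.
- by rewrite /skew_norm !mxE !normrM; ring.
- move=> N0; have n0 := normr_ge0 (x 0 0); have n1 := normr_ge0 (x 1 0).
  have n2 : 0 <= 2 / (1 - `|eta|) * `|x 1 0| by rewrite mulr_ge0 // ltW.
  apply: eq_cV2; rewrite mxE; apply/eqP; rewrite -normr_eq0.
    by rewrite eq_le n0 andbT; rewrite -N0 /skew_norm lerDl.
  have : 2 / (1 - `|eta|) * `|x 1 0| == 0.
    by rewrite eq_le n2 andbT -N0 /skew_norm lerDr.
  by rewrite mulf_eq0 (gt_eqF K0).
Qed.

Lemma skew_norm_contract d x y :
  skew_norm (F d x - F d y) <= (1 + `|eta|) / 2 * skew_norm (x - y).
Proof.
have e1 := eta1; have h0 := normr_ge0 eta.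
have subE (u v : 'cV[R]_2) i : (u - v) i 0 = u i 0 - v i 0 by rewrite !mxE.
have E0 : (F d x - F d y) 0 0 = eta * (x - y) 0 0 + (x - y) 1 0.
  by rewrite !subE !ifs_map0; ring.
have E1 : (F d x - F d y) 1 0 = eta * (x - y) 1 0.
  by rewrite !subE !ifs_map1; ring.
rewrite /skew_norm E0 E1; set a := (x - y) 0 0; set b := (x - y) 1 0.
have H1 := ler_normD (eta * a) b.
rewrite !normrM in H1 *.
have a0 := normr_ge0 a; have b0 := normr_ge0 b.
have -> : (1 + `|eta|) / 2 * (`|a| + 2 / (1 - `|eta|) * `|b|) =
    (1 + `|eta|) / 2 * `|a| + (1 + 2 / (1 - `|eta|) * `|eta|) * `|b|.
  by field; rewrite gt_eqF // subr_gt0.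
have H2 : `|eta| * `|a| <= (1 + `|eta|) / 2 * `|a| by apply: ler_wpM2r => //; lra.
lra.
Qed.

Lemma contraction_ifs d : contraction_for skew_norm (F d).
Proof.
have e1 := eta1; have h0 := normr_ge0 eta.
exists ((1 + `|eta|) / 2); first by apply/andP; split; lra.
exact: skew_norm_contract.
Qed.

(** * Comparison of sets by addresses, and a local criterion for a DGIFS *)

Lemma skew_norm_bounded A : compact A ->
  exists b, forall x y, A x -> A y -> skew_norm (x - y) <= b.
Proof.
move=> cA; have [[x0 Ax0]|A0] := pselect (A !=set0); last first.
  by exists 0 => x y Ax; case: A0; exists x.
have K0 := K_gt0.
have bnd i : exists M, forall x, A x -> `|x i 0| <= M.
  have /continuous_compact : {within A, continuous (fun x : 'cV[R]_2 => x i 0)}.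
    exact/continuous_subspaceT/coord_continuous.
  move=> /(_ cA) /compact_bounded [M [_ HM]]; exists (M + 1) => x Ax.
  by apply: (HM (M + 1)); [rewrite ltrDl|exists x].
have [M0 H0] := bnd 0; have [M1 H1] := bnd 1.
exists ((M0 + M0) + 2 / (1 - `|eta|) * (M1 + M1)) => x y Ax Ay.
rewrite /skew_norm !mxE; apply: lerD.
  by rewrite (le_trans (ler_normB _ _)) // lerD ?H0.
by rewrite ler_wpM2l ?(ltW K0) // (le_trans (ler_normB _ _)) // lerD ?H1.
Qed.

(* Both sets consist of points with the same admissible addresses, and applying
   k maps to bounded sets leaves an error of order ((1 + |eta|) / 2) ^ k. *)
Lemma itinerary_sub A (E P Q : nat -> set 'cV[R]_2) : compact A ->
  (forall k, P k = \bigcup_(d in E k) (F d @` P k.+1)) ->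
  (forall k, Q k = \bigcup_(d in E k) (F d @` Q k.+1)) ->
  (forall k, P k `<=` A) -> (forall k, Q k `<=` A) ->
  (forall k, Q k !=set0) -> closed (Q 0%N) -> P 0%N `<=` Q 0%N.
Proof.
move=> cA EP EQ PA QA Q0 clQ x Px.
have [b Hb] := skew_norm_bounded cA.
have e1 := eta1; have h0 := normr_ge0 eta.
have c0 : 0 <= (1 + `|eta|) / 2 by lra.
have approx k : forall j z, P j z ->
    exists2 y, Q j y & skew_norm (z - y) <= ((1 + `|eta|) / 2) ^+ k * b.
  elim: k => [|k IH] j z Pz.
    have [y Qy] := Q0 j; exists y => //.
    by rewrite expr0 mul1r; apply: Hb; [apply: PA Pz|apply: QA Qy].
  move: Pz; rewrite EP => -[d Ed [z' Pz' <-]].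
  have [y Qy Hy] := IH _ _ Pz'.
  exists (F d y); first by rewrite EQ; exists d => //; exists y.
  apply: le_trans (skew_norm_contract _ _ _) _.
  by rewrite exprS -[leRHS]mulrA ler_wpM2l.
apply: clQ => U /nbhs_cV2 [e e0 eU].
have c1 : `|(1 + `|eta|) / 2| < 1 by rewrite ger0_norm //; lra.
have /cvgr0Pnorm_lt /(_ e e0) [k _ /(_ k (leqnn k)) /= Hk] := cvg_geometric b c1.
have [y Qy Hy] := approx k _ _ Px.
exists y; split=> //.
rewrite -(addr_vec2 x y).
have lt_e : skew_norm (x - y) < e.
  by apply: le_lt_trans Hy _; apply: le_lt_trans Hk; rewrite mulrC; exact: ler_norm.
rewrite /skew_norm !mxE in lt_e.
have n1 := normr_ge0 (x 1 0 - y 1 0); have n0 := normr_ge0 (x 0 0 - y 0 0).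
have n2 : `|x 1 0 - y 1 0| <= 2 / (1 - `|eta|) * `|x 1 0 - y 1 0| by apply: ler_peMl.
by apply: eU; rewrite distrC; lra.
Qed.

(* Taking all arrows u -d-> v with F_d (B_v) contained in B_u makes one
   inclusion of the attractor equations automatic. *)
Lemma described_by_local S (U : finType) (B : U -> set 'cV[R]_2) :
  finite_set S -> (forall u, B u !=set0) -> (forall u, compact (B u)) ->
  (forall u x, B u x -> exists d v,
    [/\ S d, F d @` B v `<=` B u & (F d @` B v) x]) ->
  described_by_dgifs (\bigcup_u B u) S F.
Proof.
move=> /finite_seqP [s Es] B0 cB loc.
pose m := size s; pose e (i : 'I_m) := nth 0 s i.
have Se i : S (e i) by rewrite Es /=; apply: mem_nth.
have eS d : S d -> exists i, e i = d.
  rewrite Es /= => ds; have ltm : (index d s < m)%N by rewrite index_mem.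
  by exists (Ordinal ltm); rewrite /e /= nth_index.
pose ok (t : U * 'I_m * U) := `[< F (e t.1.2) @` B t.2 `<=` B t.1.1 >].
pose T : finType := {t | ok t}.
have outdeg (u : U) : exists t : T, (val t).1.1 = u.
  have [x Bx] := B0 u; have [d [v [/eS [i <-] sub _]]] := loc _ _ Bx.
  have okt : ok (u, i, v) by apply/asboolP.
  by exists (exist (fun t => is_true (ok t)) _ okt).
have contr : exists2 N : 'cV[R]_2 -> R, is_norm N &
    forall t : T, contraction_for N (F (e (val t).1.2)).
  by exists skew_norm; [exact: skew_norm_is_norm|move=> t; exact: contraction_ifs].
exists (Dgifs (fun t : T => (val t).2) outdeg contr); split.
  by move=> t; exists (e (val t).1.2).
exists B => // u; split=> //; apply/seteqP; split=> x.
  move=> Bx; have [d [v [/eS [i <-] sub Fx]]] := loc _ _ Bx.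
  have okt : ok (u, i, v) by apply/asboolP.
  by exists v => //; exists (exist (fun t => is_true (ok t)) _ okt).
move=> [v _ [t [<- <-]]] /= Fx.
by have /asboolP := valP t; apply.
Qed.

End JordanIFS.

(** * Dynamics of the face directions *)

Section Directions.
Set Implicit Arguments.
Unset Strict Implicit.
Context {R : realType} (eta : R).
Implicit Types (X D A : set 'cV[R]_2) (b : bool) (a c tau : R).
Local Notation F := (ifs_map eta).
Local Notation s := (eta < 0).
Local Notation h := (`|eta|).

(* The face in direction sigma (a, eps c), with sigma = (-1)^b and
   eps = sgn(eta): in these coordinates the transposed Jordan block acts by
   (sigma, a, c) |-> (sigma eps, |eta| a, a + |eta| c). *)
Definition dface X b a c : set 'cV[R]_2 :=
  face X ((-1) ^+ b * a) ((-1) ^+ (b (+) s) * c).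

Lemma dfaceP X b a c x : dface X b a c x <-> X x /\ forall y, X y ->
  (-1) ^+ b * (y 0 0 - x 0 0) * a + (-1) ^+ (b (+) s) * (y 1 0 - x 1 0) * c <= 0.
Proof.
have E (y : 'cV[R]_2) : (-1) ^+ b * (y 0 0 - x 0 0) * a + (-1) ^+ (b (+) s) * (y 1 0 - x 1 0) * c
    = lin ((-1) ^+ b * a) ((-1) ^+ (b (+) s) * c) y
      - lin ((-1) ^+ b * a) ((-1) ^+ (b (+) s) * c) x by rewrite /lin; ring.
split=> -[Xx H]; split=> // y /H; first by rewrite E subr_le0.
by rewrite E subr_le0.
Qed.

Lemma dface_scale X b k a c : 0 < k -> dface X b (k * a) (k * c) = dface X b a c.
Proof. by move=> k0; rewrite /dface !(mulrCA _ k) face_scale. Qed.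

Lemma dface_verticalN X b : dface X b 0 (-1) = dface X (~~ b) 0 1.
Proof. by rewrite /dface addNb !signrN !mulr0 mulr1 mulrN1. Qed.

Lemma dface_attractor D A b a c : is_attractor D F A ->
  dface A b a c = \bigcup_(d in dface D b a c)
    (F d @` dface A (b (+) s) (h * a) (a + h * c)).
Proof.
move=> hA; rewrite /dface (face_attractor _ _ hA) addbK.
have etaE : eta = (-1) ^+ s * h by exact: numEsign.
have -> : eta * ((-1) ^+ b * a) = (-1) ^+ (b (+) s) * (h * a).
  by rewrite {1}etaE signr_addb; ring.
have -> // : (-1) ^+ b * a + eta * ((-1) ^+ (b (+) s) * c) =
    (-1) ^+ b * (a + h * c).
rewrite {1}etaE signr_addb.
have : (-1) ^+ s * (-1) ^+ s = 1 :> R by rewrite -signr_addb addbb.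
move=> ss; transitivity ((-1) ^+ b * (a + (-1) ^+ s * (-1) ^+ s * (h * c))).
  by ring.
by rewrite ss mul1r.
Qed.

Lemma extreme_dface X x : extreme_points X x ->
  exists b, dface X b 0 1 x \/ exists tau, dface X b 1 tau x.
Proof.
move=> /extreme_sub_face [p [q [pq0 H]]].
have [p0|p0] := eqVneq p 0.
  rewrite p0 eqxx /= in pq0.
  (* The extra [(+) s] cancels the factor sgn(eta) that [dface] puts on the second coordinate. *)
  exists ((q < 0) (+) s); left; rewrite /dface addbK mulr0 mulr1.
  rewrite -(face_scale _ _ _ (c := `|q|)) ?normr_gt0 // mulr0.
  by rewrite mulrC -numEsign -p0.
exists (p < 0); right; exists ((-1) ^+ ((p < 0) (+) s) * q / `|p|).
rewrite /dface -(face_scale _ _ _ (c := `|p|)) ?normr_gt0 // mulr1.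
rewrite mulrC -numEsign -mulrA mulrA -signr_addb addbb mul1r.
by rewrite mulrCA divff ?normr_eq0 // mulr1.
Qed.

Lemma dface_extreme X b a c : (a != 0) || (c != 0) ->
  dface X b a c `<=` extreme_points X.
Proof.
by move=> ac0; apply: face_sub_extreme; rewrite !mulf_eq0 !signr_eq0.
Qed.

(** For slopes at least [T] the term in y dominates: x + tau y <= 0 forces y <= 0, and then a x <= a
    T |y| <= |y|. If y = 0, then x <= 0 suffices. The conclusion concerns slope 1 / a, with a = 0
    for the vertical direction. *)
Lemma eventually_sign T tau x y a : 0 < T -> y = 0 \/ `|x| < T * `|y| ->
  T <= tau -> x + tau * y <= 0 -> 0 <= a <= T^-1 -> a * x + y <= 0.
Proof.
move=> T0 [->|xy] Ttau H /andP[a0 aT].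
  by move: H; rewrite mulr0 !addr0 => x0; rewrite mulr_ge0_le0.
have aT1 : a * T <= 1 by rewrite -ler_pdivlMr // div1r.
have x1 := ler_norm x; have x2 := ler_norm (- x); rewrite normrN in x2.
have [y0|y0] := lerP 0 y.
  rewrite (ger0_norm y0) in xy.
  have x3 : T * y <= tau * y by apply: ler_wpM2r.
  lra.
rewrite (ltr0_norm y0) in xy.
have x3 : a * x <= a * (T * - y) by apply: ler_wpM2l => //; lra.
have x4 : a * T * - y <= 1 * - y by apply: ler_wpM2r => //; lra.
lra.
Qed.

(* [T] exceeds every slope at which the face of [D] can change. *)
Definition slope_bound D (T : R) := 0 < T /\ forall d e, D d -> D e ->
  e 1 0 - d 1 0 = 0 \/ `|e 0 0 - d 0 0| < T * `|e 1 0 - d 1 0|.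

Lemma slope_bound_exists D : finite_set D -> exists T, slope_bound D T.
Proof.
move=> /finite_seqP [l ->].
pose f (d e : 'cV[R]_2) := `|e 0 0 - d 0 0| / `|e 1 0 - d 1 0|.
have f0 d e : 0 <= f d e by rewrite divr_ge0.
(* The sum dominates each quotient. Pairs of equal height contribute 0, as division by 0 gives 0. *)
exists (1 + \sum_(d <- l) \sum_(e <- l) f d e); split.
  by rewrite ltr_wpDr // sumr_ge0 // => d _; rewrite sumr_ge0.
move=> d e /= dl el; have [->|n0] := eqVneq (e 1 0 - d 1 0) 0; [by left|right].
rewrite -ltr_pdivrMr ?normr_gt0 // -/(f d e).
rewrite (big_rem d) //= [X in _ < 1 + (X + _)](big_rem e) //=.
have s1 : 0 <= \sum_(j <- rem e l) f d j by rewrite sumr_ge0.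
have s2 : 0 <= \sum_(i <- rem d l) \sum_(j <- l) f i j.
  by rewrite sumr_ge0 // => i _; rewrite sumr_ge0.
lra.
Qed.

(** Only an inclusion: at a = 0 the vertical face of [D] may be larger than the face at steep
    slopes. *)
Lemma dface_tail D T b tau a : slope_bound D T -> T <= tau -> 0 <= a <= T^-1 ->
  dface D b 1 tau `<=` dface D b a 1.
Proof.
move=> [T0 HT] Ttau aT d /dfaceP [Dd H]; apply/dfaceP; split=> // e De.
rewrite mulr1 mulrC; apply: (eventually_sign T0 _ Ttau _ aT); last first.
  by have := H e De; congr (_ <= _); ring.
rewrite !normrM !normr_sign !mul1r.
by case: (HT d e Dd De) => [->|]; [left; rewrite mulr0|right].
Qed.

Lemma dface_tailN D T b tau a : slope_bound D T -> T <= tau -> 0 <= a <= T^-1 ->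
  dface D b 1 (- tau) `<=` dface D b a (-1).
Proof.
move=> [T0 HT] Ttau aT d /dfaceP [Dd H]; apply/dfaceP; split=> // e De.
rewrite mulrN1 [_ * a]mulrC; apply: (eventually_sign T0 _ Ttau _ aT); last first.
  by have := H e De; congr (_ <= _); ring.
rewrite normrN !normrM !normr_sign !mul1r.
by case: (HT d e Dd De) => [->|]; [left; rewrite mulr0 oppr0|right].
Qed.

(** Between finite slopes, [dface_tail] with a the inverse slope gives both inclusions. *)
Lemma dface_tail_eq D T b tau tau' : slope_bound D T -> T <= tau -> T <= tau' ->
  dface D b 1 tau = dface D b 1 tau'.
Proof.
move=> DT; have T0 := DT.1.
have sub t t' : T <= t -> T <= t' -> dface D b 1 t `<=` dface D b 1 t'.
  move=> tT tT'; have t'0 : 0 < t' by apply: lt_le_trans tT'.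
  have -> : dface D b 1 t' = dface D b t'^-1 1.
    by rewrite -(dface_scale _ _ t'^-1 1 t'0) divff ?gt_eqF // mulr1.
  by apply: (dface_tail DT tT); rewrite invr_ge0 ltW //= lef_pV2.
by move=> h1 h2; apply/seteqP; split; apply: sub.
Qed.

(** * Faces of the attractor and their graph *)

Hypotheses (eta0 : eta != 0) (eta1 : h < 1).

Let h_gt0 : 0 < h. Proof. by rewrite normr_gt0. Qed.

Variables (D A : set 'cV[R]_2) (T : R).
Hypotheses (finD : finite_set D) (hA : is_attractor D F A)
  (DT : slope_bound D T).

Lemma vertical_face b : dface A b 0 1 =
  \bigcup_(d in dface D b 0 1) (F d @` dface A (b (+) s) 0 1).
Proof.
by rewrite (dface_attractor _ _ _ hA) add0r -(dface_scale A _ 0 1 h_gt0).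
Qed.

Lemma sloped_face b tau : dface A b 1 tau =
  \bigcup_(d in dface D b 1 tau) (F d @` dface A (b (+) s) 1 (tau + h^-1)).
Proof.
rewrite (dface_attractor _ _ _ hA).
have -> // : dface A (b (+) s) 1 (tau + h^-1) = dface A (b (+) s) (h * 1) (1 + h * tau).
by rewrite -(dface_scale A _ _ _ h_gt0) mulrDr divff ?gt_eqF // [1 + _]addrC.
Qed.

Lemma dface_neq0 b a c : dface A b a c !=set0.
Proof. by have [A0 cA _] := hA; apply: face_neq0. Qed.

Lemma dface_compact b a c : compact (dface A b a c).
Proof. by have [A0 cA _] := hA; apply: face_compact. Qed.

(** By [itinerary_sub] a face of [A] is determined by the sequence of faces of [D] met along its
    orbit. Slopes grow by 1 / |eta| per step, so a fixed number of terms together with the sign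
    determines the sequence. *)
Lemma sloped_faces_finite (t0 : R) : exists (C : finType) (B : C -> set 'cV[R]_2),
  (forall i, exists b tau, t0 <= tau /\ B i = dface A b 1 tau) /\
  (forall b tau, t0 <= tau -> exists i, B i = dface A b 1 tau).
Proof.
have [l El] := (finite_seqP _).1 finD.
(* After [N] steps every slope starting at [t0] or above has reached [T]. *)
have [N HN] : exists N : nat, (T - t0) * h <= N%:R.
  by exists (Num.trunc `|(T - t0) * h|).+1; rewrite (le_trans (ler_norm _)) // ltW // truncnS_gt.
have tN t k : t0 <= t -> (N <= k)%N -> T <= t + k%:R * h^-1.
  move=> t0t Nk; have tk : T - t0 <= k%:R * h^-1.
    by rewrite ler_pdivlMr // (le_trans HN) // ler_nat.
  lra.
pose dirs b tau k := dface D (iter k (addb^~ s) b) 1 (tau + k%:R * h^-1).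
pose faces b tau k := dface A (iter k (addb^~ s) b) 1 (tau + k%:R * h^-1).
have facesS b tau k : faces b tau k =
    \bigcup_(d in dirs b tau k) (F d @` faces b tau k.+1).
  rewrite /faces sloped_face -/(dirs b tau k).
  by rewrite -natr1 mulrDl mul1r addrA.
(* The first [N] faces are recorded as subsets of the list [l]; beyond them the face of [D] depends
   only on the current sign, which [b] determines. *)
pose code b tau := (b, [ffun ki : 'I_N * 'I_(size l) =>
  `[< dirs b tau ki.1 (nth 0 l ki.2) >]]).
have codeP b tau b' tau' : t0 <= tau -> t0 <= tau' ->
    code b tau = code b' tau' -> forall k, dirs b tau k = dirs b' tau' k.
  move=> h1 h2 [<- Ec] k; have [Nk|kN] := leqP N k.
    by apply: (dface_tail_eq _ DT); apply: tN.
  have sub x : D x -> dirs b tau k x <-> dirs b tau' k x.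
    rewrite El /= => xl; have il : (index x l < size l)%N by rewrite index_mem.
    move/ffunP/(_ (Ordinal kN, Ordinal il)): Ec; rewrite !ffunE /= nth_index //.
    by move=> E; rewrite -(asboolE (dirs b tau k x)) E asboolE.
  by apply/seteqP; split=> x xk; apply/sub => //; case: xk.
have [A0 cA _] := hA.
have face0 b tau : faces b tau 0%N = dface A b 1 tau by rewrite /faces mul0r addr0.
have sub b tau b' tau' : t0 <= tau -> t0 <= tau' -> code b tau = code b' tau' ->
    dface A b 1 tau `<=` dface A b' 1 tau'.
  move=> h1 h2 Ec; rewrite -!face0.
  apply: (itinerary_sub eta1 cA (E := dirs b tau)) => //.
  - by move=> k; rewrite (codeP _ _ _ _ h1 h2 Ec).
  - by move=> k x [].
  - by move=> k x [].
  - by move=> k; apply: dface_neq0.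
  - by apply: compact_closed; [exact: norm_hausdorff|exact: dface_compact].
pose good i (bt : bool * R) := t0 <= bt.2 /\ code bt.1 bt.2 = i.
(* A code that no direction realises gets the default (false, t0), whose face is still in the
   family. *)
pose rep i := xget (false, t0) (good i).
exists _, (fun i => dface A (rep i).1 1 (rep i).2); split=> [i|b tau ht].
  exists (rep i).1, (rep i).2; split=> //; rewrite /rep.
  by case: xgetP => [? -> []|_ /=].
exists (code b tau).
have [h1 h2] : good (code b tau) (rep (code b tau)).
  by apply: xgetPex; exists (b, tau).
by apply/seteqP; split; apply: sub.
Qed.

(* The union over all slopes c / a in [-oo, -T]; including the vertical
   direction a = 0 makes it compact. *)
Definition steep_faces b : set 'cV[R]_2 :=
  \bigcup_(a in [set a | 0 <= a <= T^-1]) dface A b a (-1).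

Lemma steep_faces_compact b : compact (steep_faces b).
Proof.
have [_ cA _] := hA; apply: segment_faces_compact => //.
  by move=> x; apply: cvgM; [exact: cvg_cst|exact: cvg_id].
exact: cst_continuous.
Qed.

Lemma steep_faces_neq0 b : steep_faces b !=set0.
Proof.
have [x Hx] := dface_neq0 b 0 (-1); exists x, 0 => //=.
by rewrite lexx invr_ge0 ltW // DT.1.
Qed.

(** Pulling back lowers the slope -1 / a by 1 / |eta|, so it stays at most -T, where [dface_tailN]
    keeps d maximal. One d thus serves the whole union, vertical direction included. *)
Lemma steep_faces_step b tau d : T <= tau -> dface D b 1 (- tau) d ->
  F d @` steep_faces (b (+) s) `<=` steep_faces b.
Proof.
move=> Ttau Hd _ [x [a /= /andP[a0 aT] Hx] <-].
have ha0 : 0 < h + a by rewrite ltr_wpDr.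
(* Solution of h a' / (h - a') = a: the transposed block sends (a', -1) to h^2 / (h + a) times (a,
   -1), up to the sign recorded by [b]. *)
pose a' := a * h / (h + a).
have a'a : 0 <= a' <= a.
  rewrite /a' divr_ge0 ?mulr_ge0 ?(ltW ha0) //=.
  by rewrite ler_pdivrMr // ler_wpM2l // lerDl.
have a'T : 0 <= a' <= T^-1 by case/andP: a'a => -> /le_trans ->.
exists a' => //; rewrite (dface_attractor _ _ _ hA).
exists d; first exact: (dface_tailN DT Ttau a'T).
exists x => //; move: Hx.
have k0 : 0 < h ^+ 2 / (h + a) by rewrite divr_gt0 ?exprn_gt0.
rewrite -(dface_scale A _ _ _ k0).
congr (dface _ _ _ _ _); rewrite /a'; field; rewrite gt_eqF //.
Qed.

Lemma vertical_sub_steep b : dface A (~~ b) 0 1 `<=` steep_faces b.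
Proof.
move=> x Hx; exists 0; last by rewrite dface_verticalN.
by rewrite /= lexx invr_ge0 ltW // DT.1.
Qed.

Lemma sloped_sub_steep b tau : T <= tau -> dface A b 1 (- tau) `<=` steep_faces b.
Proof.
move=> Ttau x; have T0 := DT.1; have tau0 : 0 < tau by apply: lt_le_trans Ttau.
rewrite -(dface_scale A _ _ _ (_ : 0 < tau^-1)) ?invr_gt0 // => Hx.
exists tau^-1; first by rewrite /= invr_ge0 ltW //= lef_pV2.
by move: Hx; rewrite mulr1 mulrN mulVf ?gt_eqF.
Qed.

Lemma extreme_points_described :
  described_by_dgifs (extreme_points A) (extreme_points D) F.
Proof.
have T0 := DT.1.
have [C [G [Gface faceG]]] := sloped_faces_finite (- T).
have hinv0 : 0 < h^-1 by rewrite invr_gt0.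
(* With the cut at slope -T, the vertical, steep and sloped sets together cover all directions. *)
pose B (u : bool + bool + C) := match u with
  | inl (inl b) => dface A b 0 1
  | inl (inr b) => steep_faces b
  | inr i => G i
  end.
have -> : extreme_points A = \bigcup_u B u.
  apply/seteqP; split=> x.
    move=> /extreme_dface [b [H|[tau H]]]; first by exists (inl (inl b)).
    have [tauT|tauT] := lerP (- T) tau.
      by have [i Gi] := faceG b tau tauT; exists (inr i) => //=; rewrite Gi.
    exists (inl (inr b)) => //=.
    apply: (@sloped_sub_steep b (- tau)); last by rewrite opprK.
    lra.
  move=> [[[b|b]|i] _ /=].
  - by apply: dface_extreme; rewrite oner_eq0 orbT.
  - by move=> [a _]; apply: dface_extreme; rewrite oppr_eq0 oner_eq0 orbT.
  - have [b [tau [_ ->]]] := Gface i.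
    by apply: dface_extreme; rewrite oner_eq0.
apply: (described_by_local eta1).
- by apply: sub_finite_set finD => x [].
- move=> [[b|b]|i] /=; [exact: dface_neq0|exact: steep_faces_neq0|].
  by have [b [tau [_ ->]]] := Gface i; exact: dface_neq0.
- move=> [[b|b]|i] /=; [exact: dface_compact|exact: steep_faces_compact|].
  by have [b [tau [_ ->]]] := Gface i; exact: dface_compact.
have vertE b d : dface D b 0 1 d -> extreme_points D d.
  by apply: dface_extreme; rewrite oner_eq0 orbT.
have slopedE b tau d : dface D b 1 tau d -> extreme_points D d.
  by apply: dface_extreme; rewrite oner_eq0.
have vert_step b x : dface A b 0 1 x -> exists d,
    [/\ extreme_points D d, F d @` dface A (b (+) s) 0 1 `<=` dface A b 0 1 &
      (F d @` dface A (b (+) s) 0 1) x].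
  rewrite {1}vertical_face => -[d Hd Fx]; exists d; split=> //.
    exact: vertE Hd.
  by rewrite [X in _ `<=` X]vertical_face; exact: bigcup_sup Hd.
have sloped_step b tau x : dface A b 1 tau x -> exists d,
    [/\ dface D b 1 tau d,
      F d @` dface A (b (+) s) 1 (tau + h^-1) `<=` dface A b 1 tau &
      (F d @` dface A (b (+) s) 1 (tau + h^-1)) x].
  rewrite {1}sloped_face => -[d Hd Fx]; exists d; split=> //.
  by rewrite [X in _ `<=` X]sloped_face; exact: bigcup_sup Hd.
move=> [[b|b]|i] /= x.
- by move=> /vert_step [d Hd]; exists d, (inl (inl (b (+) s))).
- move=> [a /= /andP[a0 aT] Hx].
  (* For a = 0 the point lies on a vertical face, and the arrow leads to a vertical vertex. *)
  have [az|an] := eqVneq a 0.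
    move: Hx; rewrite az dface_verticalN => /vert_step [d [Sd sub Fx]].
    exists d, (inl (inl (~~ b (+) s))); split=> //.
    by apply: subset_trans sub _; apply: vertical_sub_steep.
  have ap : 0 < a by rewrite lt_def an.
  have Ta : T <= a^-1 by rewrite -(invrK T) lef_pV2 ?posrE ?invr_gt0.
  move: Hx; rewrite -(dface_scale A _ _ _ (_ : 0 < a^-1)) ?invr_gt0 //.
  rewrite mulVf // mulrN1 => /sloped_step [d [Hd sub Fx]].
  (* The next slope may leave the steep range. If so, the arrow leads to a single sloped face;
     otherwise it leads to the partner steep union, whose whole image must be controlled. *)
  have [tauT|tauT] := lerP (- T) (- a^-1 + h^-1).
    have [i Gi] := faceG (b (+) s) _ tauT.
    exists d, (inr i); rewrite /= Gi; split=> //; first exact: slopedE Hd.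
    by apply: subset_trans sub _; apply: sloped_sub_steep.
  exists d, (inl (inr (b (+) s))); split=> /=; first exact: slopedE Hd.
    exact: steep_faces_step Ta Hd.
  case: Fx => y Hy <-; exists y => //.
  apply: (@sloped_sub_steep _ (a^-1 - h^-1)); last by rewrite opprB addrC.
  lra.
- have [b [tau [tauT Gi]]] := Gface i.
  rewrite Gi => /sloped_step [d [Hd sub Fx]].
  have [j Gj] : exists j, G j = dface A (b (+) s) 1 (tau + h^-1).
    by apply: faceG; lra.
  by exists d, (inr j); rewrite /= Gj; split=> //; apply: slopedE Hd.
Qed.

End Directions.

Theorem theorem5p3 (R : realType) (n : nat) (hn : (2 <= n)%N)
    (D : set 'cV[R]_2) (hD : (D #= `I_n)%card)
    (eta : R) (heta : -1 < eta < 1) (heta0 : eta != 0)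
    (A : set 'cV[R]_2) (hA : is_attractor D (ifs_map eta) A) :
  described_by_dgifs (extreme_points A) (D `&` boundary (convex_hull D))
    (ifs_map eta).
Proof.
have finD : finite_set D by exists n.
have [T DT] := slope_bound_exists finD.
by apply: (extreme_points_described heta0 _ finD hA DT); rewrite ltr_norml.
Qed.
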